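(* Let $\mathscr{D}$ be the filtered semiring of max-plus polynomials on the barcode space. If $F\in\mathscr{D}$, then there exists a constant $C$ such that $$|F(\mathscr{B}_1)-F(\mathscr{B}_2)|\le C\,\mathrm{d}_\infty(\mathscr{B}_1,\mathscr{B}_2)$$ for every pair of barcodes $\mathscr{B}_1$ and $\mathscr{B}_2$, where $\mathrm{d}_\infty$ is the bottleneck distance.
   Context: Barcodes: an interval is encoded as $(x,d)$, with left endpoint $x\ge0$ and length $d\ge0$. $B_n$ is the orbit space of $([0,\infty)\times[0,\infty))^n$ under the action of $S_n$ permuting the $n$ pairs. The barcode space is $B=\coprod_nB_n/_\sim$, where $\sim$ is generated by $\{(x_1,d_1),\dots,(x_n,d_n)\}\sim\{(x_1,d_1),\dots,(x_{n-1},d_{n-1})\}$ whenever $d_n=0$. Bottleneck distance: for intervals put $\mathrm{d}_\infty((x_1,d_1),(x_2,d_2))=\max(|x_1-x_2|,|d_1-d_2+x_1-x_2|)$, and let the distance from an interval to the set $\Delta$ of zero-length intervals be $\mathrm{d}_\infty((x,d),\Delta)=d/2$. For barcodes $\mathscr{B}_1=\{I_\alpha\}_{\alpha\in A}$, $\mathscr{B}_2=\{J_\beta\}_{\beta\in B}$ ($A,B$ finite index sets) and a bijection $\theta:A'\to B'$ with $A'\subseteq A$, $B'\subseteq B$, let $P_\infty(\theta)=\max\big(\max_{a\in A'}\mathrm{d}_\infty(I_a,J_{\theta(a)}),\max_{a\in A\setminus A'}\mathrm{d}_\infty(I_a,\Delta),\max_{b\in B\setminus B'}\mathrm{d}_\infty(J_b,\Delta)\big)$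 (a maximum over an empty set is $0$). Then $\mathrm{d}_\infty(\mathscr{B}_1,\mathscr{B}_2)=\min_\theta P_\infty(\theta)$ over all such $\theta$. The semiring $\mathscr{D}$: a max-plus polynomial is a function of the form $\max_{1\le i\le m}(a_i+c_1^iz_1+\cdots+c_r^iz_r)$ with $m\ge1$, $a_i\in\mathbb{R}$ and nonnegative integers $c_j^i$; its degree is $\max_i(c_1^i+\cdots+c_r^i)$. $D_n$ is the semiring (operations: pointwise maximum and pointwise sum) of max-plus polynomials $p(x_1,d_1,\dots,x_n,d_n)$, regarded as functions on $([0,\infty)\times[0,\infty))^n$, such that for every $j$ the restriction of $p$ to $\{d_j=0\}$ is independent of $x_j$. $D_n^{S_n}$ is the set of elements of $D_n$ invariant under permutation of the pairs $(x_i,d_i)$, and ${}_kD_n^{S_n}$ the subset of elements of degree at most $k$. $\mathscr{D}^k$ is the inverse limit over $n$ of the maps ${}_kD_n^{S_n}\to{}_kD_{n-1}^{S_{n-1}}$, $f\mapsto f(x_1,d_1,\dots,x_{n-1},d_{n-1},0,0)$, and $\mathscr{D}=\bigcup_{k\ge1}\mathscr{D}^k$. An element $F=(f_n)_n$ of $\mathscr{D}$ is a function on $B$: $F(\mathscr{B})=f_n(\mathscr{B})$ when $\mathscr{B}$ is represented by $n$ intervals. *)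

(* Defs.v *)
From mathcomp Require Import all_boot all_order all_algebra.
From mathcomp Require Import perm generic_quotient interval_inference.
From mathcomp Require Import all_classical all_reals.
From mathcomp Require Import lra.
From Stdlib Require Import Relation_Operators.

Set Implicit Arguments.
Unset Strict Implicit.
Unset Printing Implicit Defensive.

Import Order.TTheory GRing.Theory Num.Theory.

Local Open Scope ring_scope.
Local Open Scope classical_set_scope.
Local Open Scope quotient_scope.

Definition bar (R : realType) : Type := ({nonneg R} * {nonneg R})%type.

Definition left_end (R : realType) (I : bar R) : R := I.1%:num.
Definition len (R : realType) (I : bar R) : R := I.2%:num.

(* The coproduct of the spaces of ordered families of n bars is [seq (bar R)];
   the S_n-orbits and the identification of families that differ by a last bar
   of length 0 are quotiented out together. *)
Definition barcode_step (R : realType) (s t : seq (bar R)) : Prop :=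
  perm_eq s t \/ exists2 I : bar R, len I = 0 & s = rcons t I.

Definition barcode_rel (R : realType) : rel (seq (bar R)) :=
  fun s t => `[< clos_refl_sym_trans _ (@barcode_step R) s t >].

Lemma barcode_rel_equiv (R : realType) : equiv_class_of (@barcode_rel R).
Proof.
split=> [s|s t|t s u].
- by apply/asboolP; exact: rst_refl.
- by apply/asboolP/asboolP; exact: rst_sym.
- move=> /asboolP st /asboolP tu; apply/asboolP.
  exact: rst_trans st tu.
Qed.

Canonical barcode_equiv (R : realType) :=
  EquivRelPack (@barcode_rel_equiv R).

Definition barcode (R : realType) : Type := {eq_quot @barcode_equiv R}.

(* Every function of representatives that respects [barcode_step] is
   invariant under the identification. *)
Lemma barcode_repr_ind (R : realType) (T : Type) (f : seq (bar R) -> T) :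
    (forall s t, barcode_step s t -> f s = f t) ->
  forall s, f (repr (\pi_(barcode R) s)) = f s.
Proof.
move=> fP s; case: piP => t /eqquotP /asboolP.
elim=> [x y /fP//|//|x y _ ->//|x y z _ -> _ ->//].
Qed.

Definition dinf (R : realType) (I J : bar R) : R :=
  Num.max `|left_end I - left_end J|
          `|len I - len J + left_end I - left_end J|.

Definition dinf_diag (R : realType) (I : bar R) : R := len I / 2.

(* A bijection from a subset of A to a subset of B is a partial injection;
   its domain is the set of the a such that [theta a] is not [None]. *)
Definition partial_inj (A B : finType) (theta : {ffun A -> option B}) : bool :=
  [forall a, forall a', (theta a == theta a') ==> (theta a != None) ==>
     (a == a')].

Definition matching_cost (R : realType) (A B : finType)
    (I : A -> bar R) (J : B -> bar R) (theta : {ffun A -> option B}) : R :=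
  Num.max (\big[Num.max/0]_(p : A * B | theta p.1 == Some p.2)
             dinf (I p.1) (J p.2))
 (Num.max (\big[Num.max/0]_(a | theta a == None) dinf_diag (I a))
          (\big[Num.max/0]_(b | [forall a, theta a != Some b])
             dinf_diag (J b))).

(* The empty matching only serves as an initial value: it is one of the
   partial injections over which the minimum ranges. *)
Definition bottleneck_fam (R : realType) (A B : finType)
    (I : A -> bar R) (J : B -> bar R) : R :=
  \big[Num.min/matching_cost I J [ffun=> None]]_(theta | partial_inj theta)
    matching_cost I J theta.

Definition bottleneck_seq (R : realType) (s t : seq (bar R)) : R :=
  bottleneck_fam (tnth (in_tuple s)) (tnth (in_tuple t)).

Definition bottleneck (R : realType) (b1 b2 : barcode R) : R :=
  bottleneck_seq (repr b1) (repr b2).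

Section BottleneckWellDefined.
Variable R : realType.

Lemma len_ge0 (I : bar R) : 0 <= len I.
Proof. by rewrite /len. Qed.

Lemma dinf_diag_ge0 (I : bar R) : 0 <= dinf_diag I.
Proof. by rewrite divr_ge0 ?len_ge0. Qed.

Lemma dinf_ge0 (I J : bar R) : 0 <= dinf I J.
Proof. by rewrite le_max normr_ge0. Qed.

Lemma dinf_diag_lel (I J : bar R) : len J = 0 -> dinf_diag I <= dinf I J.
Proof.
rewrite /dinf_diag /dinf => ->; have := len_ge0 I.
set l := len I; set x := left_end I; set y := left_end J => l0.
have := ler_norm (l - 0 + x - y); have := ler_norm (- (x - y)).
by rewrite normrN => h1 h2; rewrite le_max; apply/orP; lra.
Qed.

Lemma dinf_diag_ler (I J : bar R) : len I = 0 -> dinf_diag J <= dinf I J.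
Proof.
rewrite /dinf_diag /dinf => ->; have := len_ge0 J.
set l := len J; set x := left_end I; set y := left_end J => l0.
have := ler_norm (- (0 - l + x - y)); have := ler_norm (x - y).
by rewrite normrN => h1 h2; rewrite le_max; apply/orP; lra.
Qed.

Lemma partial_injP (A B : finType) (theta : {ffun A -> option B}) :
  reflect (forall a a' b, theta a = Some b -> theta a' = Some b -> a = a')
          (partial_inj theta).
Proof.
apply: (iffP idP) => [/forallP h a a' b ab a'b|h].
  by have /forallP/(_ a') := h a; rewrite ab a'b eqxx /= => /eqP.
apply/forallP => a; apply/forallP => a'; apply/implyP => /eqP e.
case ea : (theta a) => [b|//]; apply/eqP.
by apply: (h _ _ b) => //; rewrite -e.
Qed.

Lemma matching_costP (A B : finType) (I : A -> bar R) (J : B -> bar R)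
    (theta : {ffun A -> option B}) (e : R) :
  reflect [/\ 0 <= e,
    forall a b, theta a = Some b -> dinf (I a) (J b) <= e,
    forall a, theta a = None -> dinf_diag (I a) <= e &
    forall b, (forall a, theta a <> Some b) -> dinf_diag (J b) <= e]
  (matching_cost I J theta <= e).
Proof.
rewrite /matching_cost !ge_max; apply: (iffP and3P).
  move=> [/bigmax_leP[e0 h1] /bigmax_leP[_ h2] /bigmax_leP[_ h3]].
  split=> // [a b ab|a /eqP|b nb]; first by apply: (h1 (a, b)); exact/eqP.
    exact: h2.
  by apply: h3; apply/forallP => a; apply/eqP.
move=> [e0 h1 h2 h3]; split; apply/bigmax_leP; split=> //.
- by move=> [a b] /= /eqP; exact: h1.
- by move=> a /eqP; exact: h2.
- by move=> b /forallP nb; apply: h3 => a; apply/eqP.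
Qed.

Lemma bottleneck_famP (A B : finType) (I : A -> bar R) (J : B -> bar R)
    (e : R) :
  reflect (exists2 theta : {ffun A -> option B},
             partial_inj theta & matching_cost I J theta <= e)
          (bottleneck_fam I J <= e).
Proof.
have empty_inj : partial_inj ([ffun=> None] : {ffun A -> option B}).
  by apply/partial_injP => a a' b; rewrite ffunE.
apply: (iffP idP) => [|[theta th le_e]]; last first.
  by apply: le_trans le_e; exact: bigmin_le_cond.
move=> h; apply: contrapT => /forall2NP nth.
move: h; apply/negP; rewrite -ltNge.
apply/bigmin_gtP; split=> [|theta th]; rewrite ltNge; apply/negP => ?.
  by case: (nth [ffun=> None]) => /(_ _).
by case: (nth theta).
Qed.

(* Reindexing the bars and adding zero-length ones does not change the
   distance. *)
Lemma bottleneck_fam_extend (A A' B B' : finType) (g : A -> A') (h : B -> B')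
    (I : A -> bar R) (I' : A' -> bar R) (J : B -> bar R) (J' : B' -> bar R) :
    injective g -> injective h ->
    (forall a, I' (g a) = I a) -> (forall b, J' (h b) = J b) ->
    (forall a', (forall a, g a <> a') -> len (I' a') = 0) ->
    (forall b', (forall b, h b <> b') -> len (J' b') = 0) ->
  bottleneck_fam I J = bottleneck_fam I' J'.
Proof.
move=> g_inj h_inj gI hJ gI0 hJ0.
have gK a a' : [pick x | g x == a'] = Some a <-> g a = a'.
  case: pickP => [x /eqP xa|nx]; split=> [|e].
  - by case=> <-.
  - by congr Some; apply: g_inj; rewrite xa.
  - by [].
  - by have := nx a; rewrite e eqxx.
have hK b b' : [pick x | h x == b'] = Some b <-> h b = b'.
  case: pickP => [x /eqP xa|nx]; split=> [|e].
  - by case=> <-.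
  - by congr Some; apply: h_inj; rewrite xa.
  - by [].
  - by have := nx b; rewrite e eqxx.
apply/eqP; rewrite eq_le; apply/andP; split; apply/bottleneck_famP.
- have /bottleneck_famP[theta /partial_injP th] := lexx (bottleneck_fam I' J').
  set e := bottleneck_fam I' J'; move=> /matching_costP[e0 c1 c2 c3].
  pose eta := [ffun a => obind (fun b' => [pick b | h b == b']) (theta (g a))].
  have etaE a b : eta a = Some b <-> theta (g a) = Some (h b).
    rewrite ffunE; case: (theta (g a)) => [b'|//] /=.
    by split=> [/hK <- //|[->]]; apply/hK.
  exists eta.
    apply/partial_injP => a a' b /etaE ha /etaE ha'.
    exact/g_inj/(th _ _ _ ha ha').
  apply/matching_costP; split=> // [a b /etaE ab|a|b nb].
  + by rewrite -gI -hJ; exact: c1.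
  + move=> na; case ga : (theta (g a)) => [b'|]; last by rewrite -gI; exact: c2.
    rewrite -gI; apply: le_trans (c1 _ _ ga); apply: dinf_diag_lel.
    apply: hJ0 => b hb; move: ga; rewrite -hb => /etaE.
    by rewrite na.
  + rewrite -hJ; have [[a' ea']|na'] :=
      pselect (exists a', theta a' = Some (h b)); last first.
      by apply: c3 => a' ea'; apply: na'; exists a'.
    apply: le_trans (c1 _ _ ea'); apply: dinf_diag_ler.
    by apply: gI0 => a ga; apply: (nb a); apply/etaE; rewrite ga.
- have /bottleneck_famP[theta /partial_injP th] := lexx (bottleneck_fam I J).
  set e := bottleneck_fam I J; move=> /matching_costP[e0 c1 c2 c3].
  pose eta := [ffun a' => obind (fun a => omap h (theta a))
                                [pick a | g a == a']].
  have etaE a' b' : eta a' = Some b' <->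
      exists a b, [/\ g a = a', h b = b' & theta a = Some b].
    rewrite ffunE; split.
      case ea : [pick a | g a == a'] => [a|//] /=; move/gK: ea => ga.
      by case eb : (theta a) => [b|//] [<-]; exists a, b.
    by move=> [a [b [/gK -> <- /= ->]]].
  exists eta.
    apply/partial_injP => a1 a2 b' /etaE[x1 [y1 [<- <- e1]]].
    move=> /etaE[x2 [y2 [<- /h_inj y12 e2]]]; congr g.
    by apply: th e1 _; rewrite -y12.
  apply/matching_costP; split=> // [a' b' /etaE[a [b [<- <- ab]]]|a' na'|b' nb'].
  + by rewrite gI hJ; exact: c1.
  + have [[a ga]|nga] := pselect (exists a, g a = a'); last first.
      rewrite /dinf_diag gI0 ?mul0r// => a ga.
      by apply: nga; exists a.
    rewrite -ga gI; apply: c2; case ab : (theta a) => [b|//].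
    have /etaE : exists x y, [/\ g x = a', h y = h b & theta x = Some y].
      by exists a, b.
    by rewrite na'.
  + have [[b hb]|nhb] := pselect (exists b, h b = b'); last first.
      rewrite /dinf_diag hJ0 ?mul0r// => b hb.
      by apply: nhb; exists b.
    rewrite -hb hJ; apply: c3 => a ab; apply: (nb' (g a)); apply/etaE.
    by exists a, b.
Qed.

Lemma barcode_step_embed (s t : seq (bar R)) : barcode_step s t ->
  exists g : 'I_(size t) -> 'I_(size s), [/\ injective g,
    forall i, tnth (in_tuple s) (g i) = tnth (in_tuple t) i &
    forall j, (forall i, g i <> j) -> len (tnth (in_tuple s) j) = 0].
Proof.
case=> [st|[I I0 ->]].
  have ts : size t = size s by rewrite (perm_size st).
  have /tuple_permP[p ep] : perm_eq t (tcast (esym ts) (in_tuple s)).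
    by rewrite val_tcast perm_sym.
  exists (fun i => cast_ord ts (p i)); split.
  - by move=> i j /cast_ord_inj /perm_inj.
  - move=> i; set x := tnth (in_tuple s) _.
    have := congr1 (fun u => nth x u i) ep.
    rewrite -[in LHS](tnth_nth _ (in_tuple t)) => ->.
    rewrite -tnth_nth tnth_mktuple.
    by rewrite (tnth_nth x) val_tcast {1}/x (tnth_nth x).
  - move=> j /(_ (p^-1%g (cast_ord (esym ts) j))).
    by rewrite permKV cast_ordKV.
have le_st : (size t <= size (rcons t I))%N by rewrite size_rcons.
exists (widen_ord le_st); split.
- by move=> i j /(congr1 val)/= ij; exact: val_inj.
- by move=> i; rewrite !(tnth_nth I) /= nth_rcons ltn_ord.
- move=> j nj; rewrite (tnth_nth I) /= nth_rcons.
  case: ltnP => [jt|_]; last by case: ifP.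
  by case: (nj (Ordinal jt)); exact: val_inj.
Qed.

Lemma bottleneck_pi (s t : seq (bar R)) :
  bottleneck (\pi_(barcode R) s) (\pi_(barcode R) t)
    = bottleneck_seq s t.
Proof.
rewrite /bottleneck (barcode_repr_ind (f := fun u => bottleneck_seq u _)).
  rewrite (barcode_repr_ind (f := fun u => bottleneck_seq _ u))// => u v.
  move=> /barcode_step_embed[g [g_inj gE g0]].
  by apply/esym/(bottleneck_fam_extend (g := id) (h := g)) => // i /(_ i).
move=> u v /barcode_step_embed[g [g_inj gE g0]].
by apply/esym/(bottleneck_fam_extend (g := g) (h := id)) => // i /(_ i).
Qed.

End BottleneckWellDefined.

(* (a, c) is the monomial a + \sum_j c_j z_j. *)
Definition mp_mono (R : realType) (V : finType) : Type :=
  (R * {ffun V -> nat})%type.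

(* A maximum of at least one monomial. *)
Record mp_poly (R : realType) (V : finType) : Type :=
  MPPoly { mp_head : mp_mono R V; mp_tail : seq (mp_mono R V) }.

Definition mono_eval (R : realType) (V : finType) (m : mp_mono R V)
    (z : V -> R) : R :=
  m.1 + \sum_(j : V) (m.2 j)%:R * z j.

Definition mono_deg (R : realType) (V : finType) (m : mp_mono R V) : nat :=
  (\sum_(j : V) m.2 j)%N.

Definition mp_eval (R : realType) (V : finType) (P : mp_poly R V)
    (z : V -> R) : R :=
  \big[Num.max/mono_eval (mp_head P) z]_(m <- mp_tail P) mono_eval m z.

Definition mp_deg (R : realType) (V : finType) (P : mp_poly R V) : nat :=
  (\max_(m <- mp_head P :: mp_tail P) mono_deg m)%N.

(* The 2n variables: [inl j] stands for x_j and [inr j] for d_j. *)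
Definition coords (R : realType) (n : nat) (t : n.-tuple (bar R))
    (v : 'I_n + 'I_n) : R :=
  match v with
  | inl j => left_end (tnth t j)
  | inr j => len (tnth t j)
  end.

Definition represents (R : realType) (n : nat) (P : mp_poly R ('I_n + 'I_n)%type)
    (f : n.-tuple (bar R) -> R) : Prop :=
  forall t, f t = mp_eval P (coords t).

(* The degree only depends on the function, even though only nonnegative
   arguments are considered. *)
Lemma represents_deg (R : realType) (n : nat)
    (P Q : mp_poly R ('I_n + 'I_n)%type) (f : n.-tuple (bar R) -> R) :
  represents P f -> represents Q f -> mp_deg P = mp_deg Q.
Proof.
wlog suff le_deg : P Q / represents P f -> represents Q f ->
    (mp_deg Q <= mp_deg P)%N.
  by move=> Pf Qf; apply/eqP; rewrite eqn_leq !le_deg.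
move=> Pf Qf; rewrite leqNgt; apply/negP => ltPQ.
pose pt (x : {nonneg R}) : n.-tuple (bar R) := [tuple (x, x) | _ < n].
have monoE m x : mono_eval m (coords (pt x)) = m.1 + (mono_deg m)%:R * x%:num.
  rewrite /mono_eval /mono_deg natr_sum mulr_suml; congr (_ + _).
  by apply: eq_bigr => -[j|j] _; rewrite /= tnth_mktuple.
pose ms (S : mp_poly R ('I_n + 'I_n)%type) := mp_head S :: mp_tail S.
pose M : R := \big[Num.max/0]_(m <- ms P) m.1.
have upper x : mp_eval P (coords (pt x)) <= M + (mp_deg P)%:R * x%:num.
  have le1 m : m \in ms P -> mono_eval m (coords (pt x)) <=
      M + (mp_deg P)%:R * x%:num.
    move=> mP; rewrite monoE lerD ?le_bigmax_seq// ler_wpM2r//.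
    by rewrite ler_nat; exact: leq_bigmax_seq.
  rewrite /mp_eval big_seq; apply: bigmax_le => [|m mP].
    by apply: le1; rewrite mem_head.
  by apply: le1; rewrite in_cons mP orbT.
have lower x m : m \in ms Q ->
    m.1 + (mono_deg m)%:R * x%:num <= mp_eval Q (coords (pt x)).
  rewrite -monoE in_cons => /predU1P[->|mQ]; first exact: bigmax_ge_id.
  exact: (le_bigmax_seq _ _ _ (fun m => mono_eval m _)).
have [m mQ degm] : exists2 m, m \in ms Q & (mp_deg P < mono_deg m)%N.
  apply: contrapT => /forall2NP nm; move: ltPQ; apply/negP; rewrite -leqNgt.
  apply/bigmax_leqP_seq => m mQ _; rewrite leqNgt; apply/negP => ltm.
  by case: (nm m).
have x0 : 0 <= Num.max 0 (M - m.1 + 1) by rewrite le_max lexx.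
have := le_trans (lower (NngNum x0) m mQ) _; rewrite -Qf Pf.
move=> /(_ _ (upper _)); rewrite /=.
have : 1 + (mp_deg P)%:R <= (mono_deg m)%:R :> R by rewrite nat1r ler_nat.
have : M - m.1 + 1 <= Num.max 0 (M - m.1 + 1) by rewrite le_max lexx orbT.
set x := Num.max _ _ in x0 *; nra.
Qed.

Definition Dn (R : realType) (n : nat) : set (n.-tuple (bar R) -> R) :=
  [set f | (exists P, represents P f) /\
    forall (j : 'I_n) (t u : n.-tuple (bar R)),
      (forall i : 'I_n, i != j -> tnth t i = tnth u i) ->
      len (tnth t j) = 0 -> len (tnth u j) = 0 -> f t = f u].

Definition DnS (R : realType) (n : nat) : set (n.-tuple (bar R) -> R) :=
  [set f | Dn f /\
    forall (s : 'S_n) (t : n.-tuple (bar R)),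
      f [tuple tnth t (s i) | i < n] = f t].

Definition kDnS (R : realType) (k n : nat) : set (n.-tuple (bar R) -> R) :=
  [set f | DnS f /\ exists2 P, represents P f & (mp_deg P <= k)%N].

Definition bar0 (R : realType) : bar R := (0%:nng, 0%:nng).

(* The limit starts at n = 0, where the value is determined by the one at
   n = 1; the term of index n = 0 is the value at the empty barcode. *)
Definition Dk (R : realType) (k : nat) :
    set (forall n, n.-tuple (bar R) -> R) :=
  [set F | (forall n, kDnS k (F n)) /\
    forall n (t : n.-tuple (bar R)), F n.+1 [tuple of rcons t (bar0 R)] = F n t].

Definition D (R : realType) : set (forall n, n.-tuple (bar R) -> R) :=
  \bigcup_(k in [set k | (1 <= k)%N]) Dk k.

Definition D_eval (R : realType) (F : forall n, n.-tuple (bar R) -> R)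
    (b : barcode R) : R :=
  F _ (in_tuple (repr b)).

Lemma D_eval_pi (R : realType) (F : forall n, n.-tuple (bar R) -> R) :
    D F ->
  forall s, D_eval F (\pi_(barcode R) s) = F (size s) (in_tuple s).
Proof.
move=> [k _ [FD Flim]].
apply: (barcode_repr_ind (f := fun s => F _ (in_tuple s))) => s t.
have F_cast m n (e : m = n) (u : m.-tuple (bar R)) : F n (tcast e u) = F m u.
  by case: n / e; rewrite tcast_id.
case=> [st|[I I0 ->]].
  have ts : size t = size s by rewrite (perm_size st).
  have /tuple_permP[p ep] :
      perm_eq (tcast (esym ts) (in_tuple s)) (in_tuple t).
    by rewrite val_tcast.
  have [[_ F_sym] _] := FD (size t).
  rewrite -(F_cast _ _ (esym ts)).
  have -> : tcast (esym ts) (in_tuple s) =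
      [tuple tnth (in_tuple t) (p i) | i < size t] by exact: val_inj.
  exact: F_sym.
pose I' := [tuple of rcons (in_tuple t) I].
have e : size (rcons t I) = (size t).+1 by rewrite size_rcons.
rewrite -(F_cast _ _ e) -(Flim (size t)).
have -> : tcast e (in_tuple (rcons t I)) = I'.
  by apply: val_inj; rewrite /= val_tcast.
have [[[_ F_indep] _] _] := FD (size t).+1.
apply: (F_indep ord_max) => [i ni| |].
- have it : (i < size t)%N.
    rewrite ltn_neqAle -ltnS ltn_ord andbT.
    by apply: contra_neq ni => it; exact: val_inj.
  by rewrite !(tnth_nth I) /= !nth_rcons it.
- by rewrite (tnth_nth I) /= nth_rcons ltnn eqxx.
- by rewrite (tnth_nth I) /= nth_rcons ltnn eqxx /len.
Qed.

(* Main.v *)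
(** Both barcodes can be padded with zero-length bars so that an optimal
    partial matching becomes a bijection of the same cost: an unmatched bar
    (x, d) is paired with the zero-length bar (x + d/2, 0), which is at distance
    exactly d/2. Along matched pairs at distance at most e the coordinates x
    move by at most e and d by at most 2e, so a monomial of degree at most k
    moves by at most 2ke, and so does a maximum of such monomials. The constant
    2k does not depend on the number of bars since the degree is bounded along
    the inverse limit. *)
Require Import Defs.
From mathcomp Require Import all_boot all_order all_algebra.
From mathcomp Require Import generic_quotient interval_inference lra.
From mathcomp Require Import all_classical all_reals.
From Stdlib Require Import Relation_Operators.

Import Order.TTheory GRing.Theory Num.Theory.

Local Open Scope ring_scope.
Local Open Scope quotient_scope.

Set Implicit Arguments.
Unset Strict Implicit.
Unset Printing Implicit Defensive.

Lemma pi_barcode_step (R : realType) (s t : seq (bar R)) :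
  barcode_step s t -> \pi_(barcode R) s = \pi_(barcode R) t.
Proof. by move=> st; apply/eqquotP/asboolP; exact: rst_step. Qed.

Lemma pi_barcode_cat_len0 (R : realType) (s z : seq (bar R)) :
    (forall I, I \in z -> len I = 0) ->
  \pi_(barcode R) (s ++ z) = \pi_(barcode R) s.
Proof.
elim/last_ind: z => [|z I IHz] z0; first by rewrite cats0.
rewrite -rcons_cat (pi_barcode_step (t := s ++ z)).
  by apply: IHz => J Jz; apply: z0; rewrite mem_rcons in_cons Jz orbT.
by right; exists I => //; apply: z0; rewrite mem_rcons mem_head.
Qed.

Definition bar_mid (R : realType) (I : bar R) : bar R :=
  ((I.1%:num + I.2%:num / 2)%:nng, 0%:nng).

Lemma dinfC (R : realType) (I J : bar R) : dinf I J = dinf J I.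
Proof.
by rewrite /dinf distrC; congr Num.max; rewrite -normrN; congr `|_|; lra.
Qed.

Lemma dinf_bar_mid (R : realType) (I : bar R) :
  dinf I (bar_mid I) = dinf_diag I.
Proof.
rewrite /dinf /dinf_diag /left_end /len /=.
have l0 : 0 <= I.2%:num by [].
set l := I.2%:num in l0 *; set x := I.1%:num.
have -> : x - (x + l / 2) = - (l / 2) by lra.
have -> : l - 0 + x - (x + l / 2) = l / 2 by lra.
by rewrite normrN maxxx ger0_norm ?divr_ge0.
Qed.

(** The factor 2 comes from the length: a difference of lengths is the difference of the right ends
    minus that of the left ends, and [dinf] bounds each of these by [e]. *)
Lemma coords_dinf (R : realType) (n : nat) (t u : n.-tuple (bar R)) (e : R) :
    (forall i, dinf (tnth t i) (tnth u i) <= e) ->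
  forall v, coords t v <= coords u v + 2 * e.
Proof.
move=> tu v; have i_le i := tu i; rewrite /dinf in i_le.
(* The index inside [v] supplies a pair of bars; for [n] = 0 the hypothesis would not constrain
   [e]. *)
have e0 : 0 <= e by case: v => i; apply: le_trans (tu i); exact: dinf_ge0.
case: v => i /=; have := i_le i;
  by rewrite ge_max !ler_norml => /andP[/andP[? ?] /andP[? ?]]; lra.
Qed.

(** The coefficients are natural numbers, so a monomial is monotone in each variable, and raising
    all variables by [e] adds [e] times their sum. *)
Lemma mono_eval_le_shift (R : realType) (V : finType) (m : mp_mono R V)
    (z w : V -> R) (e : R) : (forall v, z v <= w v + e) ->
  mono_eval m z <= mono_eval m w + (mono_deg m)%:R * e.
Proof.
move=> zw; rewrite /mono_eval /mono_deg natr_sum mulr_suml -addrA -big_split.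
by rewrite lerD2l ler_sum// => v _ /=; rewrite -mulrDr ler_wpM2l.
Qed.

Lemma mp_eval_le_shift (R : realType) (V : finType) (P : mp_poly R V)
    (z w : V -> R) (e : R) : 0 <= e -> (forall v, z v <= w v + e) ->
  mp_eval P z <= mp_eval P w + (mp_deg P)%:R * e.
Proof.
move=> e0 zw.
have le_mono m : m \in mp_head P :: mp_tail P ->
    mono_eval m z <= mp_eval P w + (mp_deg P)%:R * e.
  move=> mP; apply: le_trans (mono_eval_le_shift m zw) _; apply: lerD.
    move: mP; rewrite in_cons => /predU1P[->|mP]; first exact: bigmax_ge_id.
    exact: (le_bigmax_seq _ _ _ (fun m => mono_eval m _)).
  by rewrite ler_wpM2r// ler_nat; exact: leq_bigmax_seq.
rewrite {1}/mp_eval big_seq; apply: bigmax_le => [|m mP]; apply: le_mono.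
  exact: mem_head.
by rewrite in_cons mP orbT.
Qed.

(** The one-sided estimate is applied in both directions. The polynomial [P] depends on [n], but
    only its degree, at most [k], enters the bound. *)
Lemma kDnS_lipschitz (R : realType) (k n : nat) (f : n.-tuple (bar R) -> R)
    (t u : n.-tuple (bar R)) (e : R) :
    kDnS k f -> (forall i, dinf (tnth t i) (tnth u i) <= e) -> 0 <= e ->
  `|f t - f u| <= (2 * k)%:R * e.
Proof.
move=> [_ [P Pf degP]] tu e0.
have ut i : dinf (tnth u i) (tnth t i) <= e by rewrite dinfC.
have e20 : 0 <= 2 * e by rewrite mulr_ge0.
have le_k : (mp_deg P)%:R * (2 * e) <= (2 * k)%:R * e.
  by rewrite mulnC natrM -mulrA ler_wpM2r// ler_nat.
have := mp_eval_le_shift P e20 (coords_dinf tu).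
have := mp_eval_le_shift P e20 (coords_dinf ut).
by rewrite -!Pf ler_norml => ? ?; apply/andP; split; lra.
Qed.

Lemma perm_map_oapp (T : Type) (U : eqType) (W : Type)
    (theta : T -> option W) (g : W -> U) (h : T -> U) (s : seq T) :
  perm_eq [seq oapp g (h a) (theta a) | a <- s]
    ([seq g b | b <- pmap theta s] ++ [seq h a | a <- s & ~~ theta a]).
Proof.
elim: s => //= a s IHs; case: (theta a) => [b|] /=; first by rewrite perm_cons.
by rewrite perm_sym -cat1s perm_catCA perm_cons perm_sym.
Qed.

(** Injectivity makes the list of matched values duplicate-free, so with the unmatched elements it
    enumerates [B] exactly once. *)
Lemma perm_matched_unmatched (A B : finType) (theta : {ffun A -> option B}) :
    partial_inj theta ->
  perm_eq (enum B) (pmap theta (enum A) ++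
                    [seq b <- enum B | [forall a, theta a != Some b]]).
Proof.
move=> /partial_injP th_inj.
have mem_th b : (b \in pmap theta (enum A)) = [exists a, theta a == Some b].
  rewrite mem_pmap; apply/mapP/existsP => [[a _ ->]|[a /eqP <-]].
    by exists a.
  by exists a => //; rewrite mem_enum.
apply: uniq_perm; first exact: enum_uniq.
  rewrite cat_uniq filter_uniq ?enum_uniq// andbT; apply/andP; split.
    elim: (enum A) (enum_uniq A) => //= a s IHs /andP[na us].
    case ea : (theta a) => [b|] /=; rewrite IHs// andbT.
    rewrite mem_pmap; apply/mapP => -[a' a's /esym ea'].
    by move: na; rewrite (th_inj _ _ _ ea ea') a's.
  apply/hasPn => b; rewrite mem_filter mem_th negb_exists => /andP[+ _].
  exact.
move=> b; rewrite mem_cat mem_filter mem_th -negb_exists mem_enum andbT.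
by rewrite orbN.
Qed.

(** A list of pairs encodes two padded families of equal size together with the bijection between
    them. *)
Lemma bar_matching_lift (R : realType) (s t : seq (bar R)) (e : R) :
    bottleneck_seq s t <= e ->
  exists L : seq (bar R * bar R),
    [/\ \pi_(barcode R) (unzip1 L) = \pi_(barcode R) s,
        \pi_(barcode R) (unzip2 L) = \pi_(barcode R) t &
        forall p, p \in L -> dinf p.1 p.2 <= e].
Proof.
move=> /bottleneck_famP[theta th /matching_costP[e0 c1 c2 c3]].
set I := tnth (in_tuple s) in c1 c2; set J := tnth (in_tuple t) in c1 c3.
have sE : s = [seq I a | a <- enum 'I_(size s)].
  by rewrite -[LHS](map_tnth_enum (in_tuple s)).
have tE : t = [seq J b | b <- enum 'I_(size t)].
  by rewrite -[LHS](map_tnth_enum (in_tuple t)).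
pose partner a := oapp J (bar_mid (I a)) (theta a).
pose free := [seq b <- enum 'I_(size t) | [forall a, theta a != Some b]].
exists ([seq (I a, partner a) | a <- enum 'I_(size s)]
          ++ [seq (bar_mid (J b), J b) | b <- free]); split.
- rewrite /unzip1 map_cat -!(map_comp fst) -sE.
  by apply: pi_barcode_cat_len0 => _ /mapP[b _ ->].
(* The second components are the matched bars of [t], the midpoints of the unmatched bars of [s],
   and the unmatched bars of [t]: a permutation of [t] followed by zero-length bars. *)
- pose unm := [seq a <- enum 'I_(size s) | ~~ theta a].
  rewrite (pi_barcode_step (t := t ++ [seq bar_mid (I a) | a <- unm])).
    by apply: pi_barcode_cat_len0 => _ /mapP[a _ ->].
  left; rewrite /unzip2 map_cat -!(map_comp snd) perm_sym.
  have /(perm_map J) := perm_matched_unmatched th; rewrite -tE map_cat => pt.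
  apply: perm_trans (perm_cat pt (perm_refl _)) _; rewrite perm_sym.
  apply: perm_trans (perm_cat (perm_map_oapp _ _ _ _) (perm_refl _)) _.
  by rewrite -!catA perm_cat2l perm_catC.
- move=> p; rewrite mem_cat => /orP[/mapP[a _ ->]|/mapP[b + ->]] /=.
    rewrite /partner; case ea : (theta a) => [b|] /=; first exact: c1.
    by rewrite dinf_bar_mid; exact: c2.
  rewrite mem_filter => /andP[/forallP nb _].
  by rewrite dinfC dinf_bar_mid; apply: c3 => a; exact/eqP.
Qed.

Lemma bottleneck_ge0 (R : realType) (B1 B2 : barcode R) : 0 <= bottleneck B1 B2.
Proof.
have /bottleneck_famP[theta _ /matching_costP[]//] := lexx (bottleneck B1 B2).
Qed.

(** Frees the index from the form [size s], so that two barcodes can be evaluated by the same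
    component of [F]. *)
Lemma D_eval_tuple (R : realType) (F : forall n, n.-tuple (bar R) -> R)
    (n : nat) (t : n.-tuple (bar R)) :
  D F -> D_eval F (\pi_(barcode R) (tval t)) = F n t.
Proof.
move=> FD; rewrite D_eval_pi//; case: t => s /= sn; have e := eqP sn.
by case: n / e sn => sn; congr F; exact: val_inj.
Qed.

Theorem theorem5p1 (R : realType) (F : forall n : nat, n.-tuple (bar R) -> R)
    (hF : D F) :
  exists C : R, forall B1 B2 : barcode R,
    `|D_eval F B1 - D_eval F B2| <= C * bottleneck B1 B2.
Proof.
have [k _ [Fk _]] := hF; exists (2 * k)%:R => B1 B2.
(* The minimum over matchings is attained, so [e] can be the bottleneck distance itself. *)
have [L [L1 L2 dL]] := bar_matching_lift (lexx (bottleneck B1 B2)).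
have -> : D_eval F B1 = F _ (map_tuple fst (in_tuple L)).
  by rewrite -D_eval_tuple// [\pi_(_) _]L1 reprK.
have -> : D_eval F B2 = F _ (map_tuple snd (in_tuple L)).
  by rewrite -D_eval_tuple// [\pi_(_) _]L2 reprK.
apply: kDnS_lipschitz => // [i|]; last exact: bottleneck_ge0.
by rewrite !tnth_map; apply: dL; exact: mem_tnth.
Qed.
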